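(* Let $q_0$ be a prime power, $q=q_0^2$, and let $s$ be a divisor of $q_0$. Let $H_s$ be any additive subgroup with $s$ elements of $H=\{c\in\mathbb F_q \mid c^{q_0}+c=0\}$. Let $\mathcal X$ be the curve obtained as the image of the Hermitian curve $\mathcal H: Y^{q_0+1}=X^{q_0}+X$ by the rational map $$\varphi:\mathcal H\to\mathcal X,\qquad (x,y)\mapsto (t,z)=\Big(\prod_{a\in H_s}(x+a),\ y\Big),$$ and let $\bar P_\infty$ be the only point at infinity of $\mathcal X$, i.e. the image under $\varphi$ of the only point at infinity $P_\infty$ of $\mathcal H$. Then the Weierstrass semigroup of $\mathcal X$ at $\bar P_\infty$ is $$H(\bar P_\infty)=\left\langle \frac{q_0}{s},\ q_0+1\right\rangle .$$
   Context: Curves are projective, geometrically irreducible, non-singular algebraic curves over a finite field (so $\mathcal X$ denotes the non-singular curve over $\mathbb F_q$ with function field $\mathbb F_q(t,z)$). For an $\mathbb F_q$-rational point $P$, $H(P)$ is the Weierstrass semigroup of non-gaps at $P$: the set of integers $n\ge 0$ such that there is a rational function with pole divisor $nP$. $\langle a,b\rangle$ denotes the numerical semigroup (containing $0$) generated by $a$ and $b$. It is known (Garcia–Stichtenoth–Xing) that $\mathcal X$ has genus $\frac12 q_0\left(\frac{q_0}{s}-1\right)$. *)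

(* Defs.v *)
From HB Require Import structures.
From mathcomp Require Import all_boot all_order all_algebra.
Set Implicit Arguments.
Unset Strict Implicit.
Unset Printing Implicit Defensive.
Import Order.TTheory GRing.Theory Num.Theory.
Local Open Scope ring_scope.

Definition prime_power (n : nat) : Prop :=
  exists p k : nat, [/\ prime p, (0 < k)%N & n = (p ^ k)%N].

(* As in [polyXY], in a bivariate polynomial p : {poly {poly F}} the outer
   variable 'X stands for X and the inner one 'X%:P for Y; [eval2 iota x y p]
   is p(x, y), the coefficients being mapped by [iota]. *)
Definition eval2 (F K : fieldType) (iota : {rmorphism F -> K}) (x y : K)
    (p : {poly {poly F}}) : K :=
  (map_poly (map_poly iota) p).[x%:P].[y].

(* K = F(x, y) *)
Definition generated_by (F K : fieldType) (iota : {rmorphism F -> K})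
    (x y : K) : Prop :=
  forall f : K, exists p r : {poly {poly F}},
    eval2 iota x y r != 0 /\ f = eval2 iota x y p / eval2 iota x y r.

(* Y^(q0+1) - (X^q0 + X) *)
Definition hermitian_poly (F : fieldType) (q0 : nat) : {poly {poly F}} :=
  ('X%:P) ^+ q0.+1 - ('X^q0 + 'X).

(* K, with coordinate functions x and y, is the function field of the affine
   plane curve h = 0: the field of fractions of F[X, Y] / (h). *)
Definition plane_curve_function_field (F K : fieldType)
    (iota : {rmorphism F -> K}) (h : {poly {poly F}}) (x y : K) : Prop :=
  (forall p : {poly {poly F}},
     eval2 iota x y p = 0 <-> exists r : {poly {poly F}}, p = r * h)
  /\ generated_by iota x y.

(* The closed points of the non-singular projective model over F of a function
   field K / F are the places of K / F, given here by their normalized discrete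
   valuations.  Since [int] has no infinity, the order of 0 is a dummy value; it
   is fixed so that a place is determined by its function [ord], and the
   axioms only concern nonzero functions. *)
Record place (F K : fieldType) (iota : {rmorphism F -> K}) := Place {
  ord :> K -> int;
  ord_zero : ord 0 = 0;
  ord_mul : forall f g : K, f != 0 -> g != 0 -> ord (f * g) = ord f + ord g;
  ord_add : forall f g : K, f != 0 -> g != 0 -> f + g != 0 ->
    Num.min (ord f) (ord g) <= ord (f + g);
  ord_const : forall c : F, c != 0 -> ord (iota c) = 0;
  ord_uniformizer : exists f : K, f != 0 /\ ord f = 1
}.

Definition same_place (F K : fieldType) (iota : {rmorphism F -> K})
    (P Q : place iota) : Prop := ord P =1 ord Q.

(* The coefficient max(0, - v_P(f)) of P in the pole divisor of f. *)
Definition pole_order (F K : fieldType) (iota : {rmorphism F -> K})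
    (P : place iota) (f : K) : nat :=
  if P f < 0 then `|P f|%N else 0%N.

(* The pole divisor of f is n P. *)
Definition pole_divisor_eq (F K : fieldType) (iota : {rmorphism F -> K})
    (f : K) (n : nat) (P : place iota) : Prop :=
  pole_order P f = n /\
  forall Q : place iota, ~ same_place Q P -> pole_order Q f = 0%N.

Definition weierstrass_semigroup (F K : fieldType)
    (iota : {rmorphism F -> K}) (P : place iota) (n : nat) : Prop :=
  exists f : K, f != 0 /\ pole_divisor_eq f n P.

Definition semigroup2 (a b : nat) (n : nat) : Prop :=
  exists i j : nat, n = (i * a + j * b)%N.

(* P is a point at infinity with respect to the affine coordinates x and y. *)
Definition at_infinity (F K : fieldType) (iota : {rmorphism F -> K})
    (x y : K) (P : place iota) : Prop :=
  P x < 0 \/ P y < 0.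

(* Pbar is the image of P under the map of curves with comorphism phi, that is,
   the place of E lying below P: its valuation ring is the preimage of that
   of P. *)
Definition image_place (F K E : fieldType) (iotaK : {rmorphism F -> K})
    (iotaE : {rmorphism F -> E}) (phi : {rmorphism E -> K})
    (P : place iotaK) (Pbar : place iotaE) : Prop :=
  forall f : E, (0 <= Pbar f) <-> (0 <= P (phi f)).

(* E, with coordinate functions t and z, is the function field of the image of
   the curve with function field K under the rational map (t0, z0); phi is the
   comorphism, identifying E with the subfield F(t0, z0) of K. *)
Definition image_curve_function_field (F K E : fieldType)
    (iotaK : {rmorphism F -> K}) (iotaE : {rmorphism F -> E})
    (phi : {rmorphism E -> K}) (t0 z0 : K) (t z : E) : Prop :=
  [/\ forall c : F, phi (iotaE c) = iotaK c,
      phi t = t0, phi z = z0 & generated_by iotaE t z].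

(* Main.v *)
Require Import Defs.
From HB Require Import structures.
From mathcomp Require Import all_boot all_order all_algebra.
From mathcomp Require Import all_solvable all_field.
From mathcomp Require Import ring zify.
From Stdlib Require Import ClassicalEpsilon.
Set Implicit Arguments.
Unset Strict Implicit.
Unset Printing Implicit Defensive.
Import Order.TTheory GRing.Theory Num.Theory.
Local Open Scope ring_scope.

(** Let T = \prod_(a in Hs) (X + a).  The polynomial X^q0 + X is invariant under
    the translations by [Hs], hence it is G(T) for a monic polynomial G of degree
    m = q0/s; as X^q0 + X has derivative 1, the derivative of G is a nonzero
    constant ([additive_quotient]).  The image curve is therefore
    G(t) = z^d with d = q0 + 1, and m and d are coprime.  For every such curve
    the semigroup at infinity is generated by m and d
    ([weierstrass_semigroup_curve]), for the following reasons.

    At a place at infinity the orders of z and t are -m e and -d e, for some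
    e > 0.  Since m and d are coprime, the monomials z^j t^i with i < m have
    distinct orders there; so they are linearly independent, and the order of a
    combination P(z, t) of them is -W e for a weight W in the semigroup that
    depends on P only ([ord_reduced]).  All functions are quotients P(z, t) / a(z)
    ([reduced_fraction]), so all their orders are multiples of e, whence e = 1,
    and there is only one place at infinity ([infinity_index1],
    [infinity_unique]).  The functions z^j t^i then show that the semigroup
    contains the one generated by m and d.  For the converse it suffices that a
    function f = P(z, t) / a(z) with no pole at finite distance is a polynomial
    in z and t ([regular_function]): its order at infinity is then -W.

    The last point is the smoothness of the affine curve, in this form.  If a is
    not constant, let al be one of its roots in a finite extension of F; common
    factors of a and of the coefficients of P being cancelled, P(al, T) is not
    the zero polynomial.  Because G(T) - al^d is separable of degree m, larger
    than the degree of P(al, T), it has a root be, in a further finite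
    extension L, with P(al, be) <> 0 ([separating_point]).  The local ring at the point
    z = al, t = be is a discrete valuation ring with uniformizer z^N - z, where N
    is the cardinal of L ([place_of_point]); the corresponding place is a pole of f.  That z^N - z is
    a uniformizer comes from the Frobenius map of L, which fixes the point:
    p^N - p is divisible by z^N - z in the local ring for each p in F[z, t]
    ([Frobenius_congr]), so that if p vanishes at the point, then
    p (p^(N-1) - 1), and p itself, is a multiple of z^N - z. *)

(** * Evaluation of bivariate polynomials *)

HB.instance Definition _ (F K : fieldType) (iota : {rmorphism F -> K})
    (x y : K) :=
  GRing.RMorphism.copy (eval2 iota x y)
    (horner_eval y \o (horner_eval x%:P \o map_poly (map_poly iota))).

Section Eval2.

Variables (F K : fieldType) (iota : {rmorphism F -> K}) (x y : K).

Lemma eval2C (a : {poly F}) : eval2 iota x y a%:P = (map_poly iota a).[y].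
Proof. by rewrite /eval2 map_polyC hornerC. Qed.

Lemma eval2X : eval2 iota x y 'X = x.
Proof. by rewrite /eval2 map_polyX hornerX hornerC. Qed.

Lemma eval2_polyC (a : {poly F}) :
  eval2 iota x y (map_poly polyC a) = (map_poly iota a).[x].
Proof.
elim/poly_ind: a => [|a c IH]; first by rewrite !rmorph0 horner0.
rewrite !rmorphD !rmorphM /= !map_polyX !map_polyC !eval2X /= eval2C map_polyC.
by rewrite /= IH !hornerE.
Qed.

Lemma eval2_horner (p : {poly {poly F}}) :
  eval2 iota x y p =
  (map_poly (horner_eval y \o map_poly iota) p).[x].
Proof.
elim/poly_ind: p => [|p a IH]; first by rewrite !rmorph0 horner0.
rewrite !rmorphD !rmorphM /= !map_polyX !map_polyC !eval2X eval2C /=.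
by rewrite IH !hornerE.
Qed.

End Eval2.

(** * Valuations *)

Section Valuation.

Variables (F K : fieldType) (iota : {rmorphism F -> K}) (v : place iota).

Lemma ord_one : v 1 = 0.
Proof. by rewrite -(rmorph1 iota) ord_const ?oner_neq0. Qed.

Lemma ordN f : v (- f) = v f.
Proof.
have [->|f0] := eqVneq f 0; first by rewrite oppr0.
have N1 : (-1 : F) != 0 by rewrite oppr_eq0 oner_neq0.
have e : - f = iota (-1) * f by rewrite rmorphN1 mulN1r.
by rewrite e ord_mul ?fmorph_eq0 // ord_const // add0r.
Qed.

Lemma ordX f n : f != 0 -> v (f ^+ n) = v f *+ n.
Proof.
move=> f0; elim: n => [|n IH]; first by rewrite ord_one.
by rewrite exprS ord_mul ?expf_neq0 // IH mulrS.
Qed.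

Lemma ord_div f g : f != 0 -> g != 0 -> v (f / g) = v f - v g.
Proof.
move=> f0 g0; have := @ord_mul _ _ _ v (f / g) g.
by rewrite divfK // mulf_eq0 negb_or f0 invr_eq0 g0 => /(_ isT isT) ->; rewrite addrK.
Qed.

Lemma ord_ge0M f g : 0 <= v f -> 0 <= v g -> 0 <= v (f * g).
Proof.
have [->|f0] := eqVneq f 0; first by rewrite mul0r.
have [->|g0] := eqVneq g 0; first by rewrite mulr0.
by move=> vf vg; rewrite ord_mul // addr_ge0.
Qed.

Lemma ord_ge0D f g : 0 <= v f -> 0 <= v g -> 0 <= v (f + g).
Proof.
have [->|f0] := eqVneq f 0; first by rewrite add0r.
have [->|g0] := eqVneq g 0; first by rewrite addr0.
have [->|fg0] := eqVneq (f + g) 0; first by rewrite ord_zero.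
by move=> vf vg; apply: le_trans (ord_add v f0 g0 fg0); rewrite le_min vf.
Qed.

Lemma ord_ge0_const c : 0 <= v (iota c).
Proof.
by have [->|c0] := eqVneq c 0; rewrite ?rmorph0 ?ord_zero // ord_const.
Qed.

Lemma ord_ge0_horner x (p : {poly F}) : 0 <= v x -> 0 <= v (map_poly iota p).[x].
Proof.
move=> vx; elim/poly_ind: p => [|p c IH]; first by rewrite rmorph0 horner0 ord_zero.
rewrite rmorphD rmorphM /= map_polyX map_polyC !hornerE.
by rewrite ord_ge0D ?ord_ge0_const // ord_ge0M.
Qed.

(** Otherwise both terms of f = (f + g) - g would have an order larger than that
    of f. *)
Lemma ord_lt_add f g : f != 0 -> g != 0 -> v f < v g ->
  f + g != 0 /\ v (f + g) = v f.
Proof.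
move=> f0 g0 fg; have s0 : f + g != 0.
  by apply: contraTneq fg => /eqP; rewrite addr_eq0 => /eqP ->; rewrite ordN ltxx.
split=> //; apply/eqP; rewrite eq_le; apply/andP; split; last first.
  by apply: le_trans (ord_add v f0 g0 s0); rewrite le_min lexx ltW.
have := @ord_add _ _ _ v (f + g) (- g) s0; rewrite addrK oppr_eq0 ordN.
by move=> /(_ g0 f0); rewrite ge_min [X in _ || X]leNgt fg orbF.
Qed.

Lemma ord_horner x (p : {poly F}) : v x < 0 -> p != 0 ->
  (map_poly iota p).[x] != 0 /\
  v (map_poly iota p).[x] = v x *+ (size p).-1.
Proof.
move=> vx; elim/poly_ind: p => [|p c IH]; first by rewrite eqxx.
have x0 : x != 0 by apply: contraTneq vx => ->; rewrite ord_zero.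
rewrite rmorphD rmorphM /= map_polyX map_polyC !hornerE -/(map_poly iota p).
rewrite size_MXaddC.
have [->|p0] := eqVneq p 0 => /=.
  rewrite mul0r rmorph0 horner0 mul0r !add0r polyC_eq0.
  by move=> c0; rewrite fmorph_eq0 c0 ord_const // (negPf c0) size_poly0.
move=> _; have [q0 vq] := IH p0.
have e : v ((map_poly iota p).[x] * x) = v x *+ size p.
  by rewrite ord_mul // vq -mulrSr prednK // size_poly_gt0.
have [->|c0] := eqVneq c 0.
  by rewrite rmorph0 addr0 mulf_neq0.
have [|||n0 ->] := @ord_lt_add ((map_poly iota p).[x] * x) (iota c).
- by rewrite mulf_neq0.
- by rewrite fmorph_eq0.
- by rewrite e ord_const // pmulrn_llt0 // size_poly_gt0.
by [].
Qed.

End Valuation.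

(** * The place of a discrete valuation ring *)

Section PlaceOfUniformizer.

Variables (F K : fieldType) (iota : {rmorphism F -> K}).
Variables (O : K -> Prop) (pi : K).
Hypotheses (O_const : forall c, O (iota c))
  (O_add : forall f g, O f -> O g -> O (f + g))
  (O_mul : forall f g, O f -> O g -> O (f * g))
  (pi_neq0 : pi != 0) (O_pi : O pi) (nO_piV : ~ O pi^-1).

Definition local_unit f := [/\ f != 0, O f & O f^-1].

Hypothesis O_fact :
  forall f, f != 0 -> exists k : int, local_unit (f / pi ^ k).

Lemma O_expz k : 0 <= k -> O (pi ^ k).
Proof.
case: k => // n _; rewrite -exprnP.
elim: n => [|n IH]; last by rewrite exprS; apply: O_mul.
by rewrite expr0 -(rmorph1 iota).
Qed.

Lemma local_unit_ge0 f k : f != 0 -> local_unit (f / pi ^ k) -> O f <-> 0 <= k.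
Proof.
move=> f0 [u0 Ou OuV]; split=> [Of|k0]; last first.
  by rewrite -(divfK (expfz_neq0 k pi_neq0) f); apply: O_mul => //; apply: O_expz.
rewrite leNgt; apply/negP=> kn; apply: nO_piV.
have -> : pi^-1 = f * (f / pi ^ k)^-1 * pi ^ (- 1 - k).
  rewrite invf_div mulrCA divff // mulr1 -expfzDr //.
  by rewrite addrC subrK exprN1.
apply: O_mul (O_mul Of OuV) _; apply: O_expz; lia.
Qed.

(** The hypotheses make [O] a discrete valuation ring with uniformizer [pi]: the
    exponent of [pi] in the factorization of a function is unique, because the
    inverse of [pi] is not in [O], and this exponent is the valuation. *)
Lemma place_of_uniformizer : exists Q : place iota,
  forall f, f != 0 -> (O f <-> 0 <= Q f).
Proof.
have ex f : exists k : int, f != 0 -> local_unit (f / pi ^ k).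
  by have [->|/O_fact[k]] := eqVneq f 0; [exists 0 | exists k].
pose w f := sval (constructive_indefinite_description _ (ex f)).
have wP f : f != 0 -> local_unit (f / pi ^ w f).
  by rewrite /w; case: (constructive_indefinite_description _ _).
have w_uniq f k : f != 0 -> local_unit (f / pi ^ k) -> w f = k.
  (* f / pi^l1 is in O, and its quotient by pi^(l2 - l1) is a unit: hence the
     exponent l2 - l1 is nonnegative *)
  have shift l (i : int) : f / pi ^ (l + i) = f / pi ^ l / pi ^ i.
    by rewrite expfzDr // invfM mulrA.
  have le l1 l2 : f != 0 -> local_unit (f / pi ^ l1) ->
      local_unit (f / pi ^ l2) -> l1 <= l2.
    move=> f0 u1 u2; rewrite -subr_ge0; have [n0 Of _] := u1.
    apply/(local_unit_ge0 n0) => //.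
    by rewrite -shift addrC subrK.
  by move=> f0 uk; apply/eqP; rewrite eq_le !le //; apply: wP.
pose ord f : int := if f == 0 then 0 else w f.
have unit1 : local_unit 1.
  by split; rewrite ?oner_neq0 // ?invr1 -(rmorph1 iota).
have ordE f : f != 0 -> ord f = w f by rewrite /ord; case: eqVneq.
have ord_m f g : f != 0 -> g != 0 -> ord (f * g) = ord f + ord g.
  move=> f0 g0; have fg0 : f * g != 0 by rewrite mulf_neq0.
  rewrite !ordE //; apply: w_uniq => //.
  have -> : f * g / pi ^ (w f + w g) = (f / pi ^ w f) * (g / pi ^ w g).
    by rewrite expfzDr // invfM mulrACA.
  have [u0 Ou OuV] := wP f f0; have [v0 Ov OvV] := wP g g0.
  by split; [rewrite mulf_neq0 | apply: O_mul | rewrite invfM; apply: O_mul].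
have ge0P f : f != 0 -> O f <-> 0 <= ord f.
  by move=> f0; rewrite ordE //; apply: local_unit_ge0 (wP f f0).
have ord_a f g : f != 0 -> g != 0 -> f + g != 0 ->
    Num.min (ord f) (ord g) <= ord (f + g).
  wlog le_fg : f g / ord f <= ord g => [IH | f0 g0 s0].
    move=> f0 g0 s0; case: (leP (ord f) (ord g)) => [le|/ltW le].
      by have := IH f g le f0 g0 s0; rewrite min_l.
    by have := IH g f le g0 f0; rewrite addrC min_l // => /(_ s0).
  rewrite min_l //.
  have gf0 : g / f != 0 by rewrite mulf_neq0 ?invr_eq0.
  have e : f + g = f * (1 + g / f) by rewrite mulrDr mulr1 mulrC divfK.
  have t0 : 1 + g / f != 0 by apply: contraNneq s0 => t0; rewrite e t0 mulr0.
  rewrite e ord_m // lerDl; apply/(ge0P _ t0); apply: O_add.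
    by have [] := unit1.
  apply/(ge0P _ gf0); have := ord_m (g / f) f; rewrite divfK // => eg.
  by move: le_fg; rewrite eg // lerDr.
have ord_c c : c != 0 -> ord (iota c) = 0.
  move=> c0; have c1 : iota c != 0 by rewrite fmorph_eq0.
  by rewrite ordE //; apply: w_uniq; rewrite // expr0z divr1; split;
    rewrite -?fmorphV.
have ord_pi : ord pi = 1.
  by rewrite ordE //; apply: w_uniq; rewrite // expr1z divff.
have ord0 : ord 0 = 0 by rewrite /ord eqxx.
have ord_u : exists f, f != 0 /\ ord f = 1 by exists pi.
by exists (Place ord0 ord_m ord_a ord_c ord_u).
Qed.

End PlaceOfUniformizer.

(** * The Frobenius map of a finite extension of a finite field *)

Section Frobenius.

Variables (F L : finFieldType) (j : {rmorphism F -> L}).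

Lemma expf_card_sub (c : F) : c ^+ #|L| = c.
Proof. by apply: (fmorph_inj j); rewrite rmorphXn /= expf_card. Qed.

Lemma card_pnat p : p \in [pchar L] -> p.-nat #|L|.
Proof.
move=> pL; have := abelem_pgroup (fin_ring_pchar_abelem pL).
by rewrite /pgroup cardsT.
Qed.

Lemma card_pnat_pchar (R : comNzRingType) (f : {rmorphism F -> R}) :
  [pchar R].-nat #|L|.
Proof.
have [p pr_p pL] := finPcharP L.
have pR : p \in [pchar R] by rewrite (rmorph_pchar f) // -(fmorph_pchar j).
rewrite (eq_pnat _ (pcharf_eq pR)).
exact: card_pnat pL.
Qed.

Lemma dvdp_Frobenius_sub (g : {poly F}) :
  exists D, g ^+ #|L| - g = D * ('X^#|L| - 'X).
Proof.
have polyN := card_pnat_pchar (polyC : {rmorphism F -> {poly F}}).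
elim/poly_ind: g => [|g c [D IH]].
  by exists 0; rewrite expr0n (gtn_eqF (ltnW (finNzRing_gt1 L))) mul0r subrr.
exists (D * 'X^#|L| + g).
rewrite exprDn_pchar // exprMn -polyC_exp expf_card_sub.
have -> : g ^+ #|L| = D * ('X^#|L| - 'X) + g by rewrite -IH subrK.
ring.
Qed.

Lemma natr_card_poly : #|L|%:R = 0 :> {poly F}.
Proof.
have [p pr_p pL] := finPcharP L.
have pP : p \in [pchar {poly F}] by rewrite pchar_poly -(fmorph_pchar j).
have /p_natP[k eN] := card_pnat pL.
have := finNzRing_gt1 L; rewrite eN; case: k {eN} => // k _.
by rewrite expnS natrM (pcharf0 pP) mul0r.
Qed.

Lemma deriv_exp_card (g : {poly F}) : (g ^+ #|L|)^`() = 0.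
Proof. by rewrite deriv_exp -mulr_natr natr_card_poly mulr0. Qed.

(** The N-th power has derivative 0: differentiating the equation and evaluating
    at a root of X^N - X leaves the value of [D] only. *)
Lemma Frobenius_quotient (G D : {poly F}) (c : F) (b : L) :
  G^`() = c%:P -> G ^+ #|L| - G = D * ('X^#|L| - 'X) ->
  (map_poly j D).[b] = j c.
Proof.
move=> dG /(congr1 (fun p => (map_poly j p^`()).[b])) /=.
rewrite derivM !derivB !deriv_exp_card derivX dG !sub0r.
rewrite mulrN1 rmorphB rmorphM !rmorphB rmorphN /= map_polyC !map_polyXn map_polyX.
by rewrite !hornerE expf_card subrr mulr0 sub0r => /oppr_inj.
Qed.

(** All roots of X^N - X are simple, its derivative being -1. *)
Lemma Frobenius_simple_root (b g : {poly F}) (x : L) :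
  'X^#|L| - 'X = b * g -> root (map_poly j g) x -> (map_poly j b).[x] != 0.
Proof.
move=> /(congr1 (fun p => (map_poly j p^`()).[x])) /=.
rewrite derivM derivB deriv_exp_card derivX sub0r rmorphN rmorph1 rmorphD !rmorphM.
rewrite /= !hornerE => e /rootP g0.
by apply: contra_eq_neq e => ->; rewrite g0 mulr0 mul0r addr0 oppr_eq0 oner_neq0.
Qed.

End Frobenius.

(** * Extensions of a finite field generated by roots *)

Lemma finite_splitting (F : finFieldType) (p : {poly F}) : p != 0 ->
  exists (L : finFieldType) (j : {rmorphism F -> L}) (rs : seq L),
    map_poly j p %= \prod_(x <- rs) ('X - x%:P).
Proof.
move=> /FinSplittingFieldFor[L [rs Hrs _]].
by exists (FinFieldExtType L), (in_alg L), rs.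
Qed.

Lemma finite_root (F : finFieldType) (p : {poly F}) : (1 < size p)%N ->
  exists (L : finFieldType) (j : {rmorphism F -> L}) (x : L),
    root (map_poly j p) x.
Proof.
move=> sp; have p0 : p != 0 by rewrite -size_poly_gt0 ltnW.
have [L [j [[|x rs] e]]] := finite_splitting p0.
  have := eqp_size e; rewrite big_nil size_map_poly size_poly1 => s1.
  by rewrite s1 in sp.
by exists L, j, x; rewrite (eqp_root e) root_prod_XsubC mem_head.
Qed.

Lemma common_divisor (F L : fieldType) (j : {rmorphism F -> L}) (x : L)
    (a : {poly F}) (s : seq {poly F}) :
  root (map_poly j a) x -> all (fun p => root (map_poly j p) x) s ->
  exists g, [/\ root (map_poly j g) x, g %| a & all (dvdp g) s].
Proof.
move=> ax; elim: s => [|p s IH] /=; first by exists a.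
case/andP=> px /IH[g [gx ga gs]]; exists (gcdp p g); split.
- by rewrite gcdp_map root_gcd px.
- exact: dvdp_trans (dvdp_gcdr p g) ga.
rewrite dvdp_gcdl; apply: sub_all gs => r; exact: dvdp_trans (dvdp_gcdr p g).
Qed.

(** * The curve G(t) = z^d and its points *)

Section Curve.

Import Pdiv.Ring.

Variables (F : finFieldType) (G : {poly F}) (m d : nat) (c : F).
Hypotheses (G_monic : G \is monic) (size_G : size G = m.+1)
  (m_gt0 : (0 < m)%N) (d_gt0 : (0 < d)%N) (co_md : coprime m d)
  (c_neq0 : c != 0) (deriv_G : G^`() = c%:P).

(** The polynomial G(T) - Z^d, where T is the outer variable. *)
Definition curve_poly : {poly {poly F}} := map_poly polyC G - ('X^d)%:P.

Lemma eval2_curve_poly (K : fieldType) (iota : {rmorphism F -> K}) x y :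
  (map_poly iota G).[x] = y ^+ d -> eval2 iota x y curve_poly = 0.
Proof.
by move=> e; rewrite raddfB /= eval2_polyC eval2C map_polyXn hornerXn e subrr.
Qed.

Lemma curve_divp (p : {poly {poly F}}) :
  exists q r, p = q * curve_poly + r /\ (size r <= m)%N.
Proof.
have sG : size (map_poly polyC G) = m.+1.
  by rewrite size_map_inj_poly //; apply: polyC_inj.
have sC : (size (- ('X^d : {poly F})%:P) < size (map_poly polyC G))%N.
  by rewrite sG size_polyN ltnS (leq_trans (size_polyC_leq1 _)).
have s_h : size curve_poly = m.+1 by rewrite size_polyDl.
have h_monic : curve_poly \is monic.
  rewrite monicE lead_coefDl // lead_coef_map_inj //; last exact: polyC_inj.
  by rewrite (monicP G_monic).
exists (rdivp p curve_poly), (rmodp p curve_poly).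
split; first exact: Pdiv.RingMonic.rdivp_eq.
by rewrite -ltnS -s_h ltn_rmodpN0 // -size_poly_gt0 s_h.
Qed.

(** Over each value of the coordinate z there are m distinct points of the
    curve, because G(T) - z^d is separable; a polynomial in T of degree less
    than m cannot vanish at all of them. *)
Lemma separating_point (L : finFieldType) (j : {rmorphism F -> L}) (al : L)
    (P : {poly {poly F}}) :
  (size P <= m)%N -> ~~ all (fun p => root (map_poly j p) al) P ->
  exists (L' : finFieldType) (k : {rmorphism L -> L'}) (be : L'),
    (map_poly (k \o j) G).[be] = k al ^+ d /\ eval2 (k \o j) be (k al) P != 0.
Proof.
move=> sP nP.
pose h := map_poly j G - (al ^+ d)%:P.
have sh : size h = m.+1.
  rewrite size_polyDl size_map_poly size_G // size_polyN ltnS.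
  exact: leq_trans (size_polyC_leq1 _) m_gt0.
have h0 : h != 0 by rewrite -size_poly_gt0 sh.
have [L' [k [rs e]]] := finite_splitting h0.
have rs_uniq : uniq rs.
  rewrite -separable_prod_XsubC -(eqp_separable e) separable_map unlock.
  rewrite derivB derivC subr0 deriv_map deriv_G map_polyC /=.
  rewrite (@eqp_coprimepr _ _ _ 1) ?coprimep1 // polyC_eqp1.
  by rewrite fmorph_eq0.
have size_rs : size rs = m.
  have := eqp_size e; rewrite size_map_poly sh size_prod_XsubC.
  by case.
pose PL := map_poly (horner_eval al \o map_poly j) P.
have PL0 : PL != 0.
  apply: contra nP => /eqP PL0; apply/(all_nthP 0) => i _.
  have := congr1 (fun p : {poly L} => p`_i) PL0.
  by rewrite coef_map coef0 /= => /rootP.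
have rs_h be : be \in rs -> (map_poly (k \o j) G).[be] = k al ^+ d.
  rewrite -root_prod_XsubC -(eqp_root e) rmorphB /= map_polyC -map_poly_comp.
  by move=> /rootP; rewrite !hornerE -rmorphXn => /eqP; rewrite subr_eq0 => /eqP.
have ePL be : eval2 (k \o j) be (k al) P = (map_poly k PL).[be].
  rewrite eval2_horner -map_poly_comp; congr (_.[be]); apply: eq_map_poly => p /=.
  by rewrite /horner_eval map_poly_comp horner_map.
have : ~~ all (root (map_poly k PL)) rs.
  apply/negP=> H; have := max_poly_roots _ H rs_uniq.
  rewrite map_poly_eq0 => /(_ PL0); rewrite size_rs size_map_poly.
  by rewrite ltnNge (leq_trans (size_poly _ _)).
case/allPn=> be be_rs nroot; exists L', k, be; split; first exact: rs_h.
by rewrite ePL.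
Qed.

Variables (E : fieldType) (iota : {rmorphism F -> E}) (t z : E).
Hypothesis curve_eq : (map_poly iota G).[t] = z ^+ d.

Local Notation ev := (eval2 iota t z).

(** ** The place at infinity *)

(** The equation of the curve only determines the orders at infinity up to the
    common factor [e], which is 1 once [t] and [z] generate the field. *)
Definition infinity_orders (v : place iota) (e : nat) :=
  [/\ (0 < e)%N, v z = - (m * e)%N%:Z & v t = - (d * e)%N%:Z].

Lemma at_infinity_orders (v : place iota) : at_infinity t z v ->
  exists e, infinity_orders v e.
Proof.
have G0 : G != 0 by rewrite monic_neq0.
have vGt : v t < 0 -> z != 0 /\ v t *+ m = v z *+ d.
  move=> vt; have [n0] := ord_horner vt G0.
  rewrite size_G /= curve_eq; rewrite curve_eq expf_eq0 d_gt0 /= in n0.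
  by rewrite ordX.
have vtz : v z < 0 -> v t < 0.
  move=> vz; rewrite ltNge; apply/negP=> vt.
  have z0 : z != 0 by apply: contraTneq vz => ->; rewrite ord_zero.
  have := ord_ge0_horner G vt; rewrite curve_eq ordX // leNgt.
  by rewrite pmulrn_llt0 // vz.
move=> inf; have vt : v t < 0 by case: inf => //; apply: vtz.
have [z0 e1] := vGt vt.
have : (m %| `|v z|)%N.
  rewrite -(@Gauss_dvdr _ d) //; apply/dvdnP; exists `|v t|%N; lia.
case/dvdnP=> e ez; exists e.
have vz : v z = - (m * e)%N%:Z by lia.
have vt' : v t = - (d * e)%N%:Z.
  apply/eqP; rewrite -(@eqr_pMn2r _ m) // e1 vz; apply/eqP; lia.
by split=> //; lia.
Qed.

(** The monomials z^j t^i with i < m have pairwise distinct orders at infinity,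
    as m and d are coprime: no cancellation can occur between them.  The weight
    [W] depends on [P] only, so that all places at infinity agree. *)
Lemma ord_reduced (P : {poly {poly F}}) : P != 0 -> (size P <= m)%N ->
  exists2 W, semigroup2 m d W & forall (v : place iota) e,
    infinity_orders v e -> ev P != 0 /\ v (ev P) = - (W * e)%N%:Z.
Proof.
move=> P0 sP.
suff /(_ m P (leqnn m) P0 sP) [i [j [_ H]]] : forall n (P : {poly {poly F}}),
    (n <= m)%N -> P != 0 -> (size P <= n)%N -> exists i j, (i < n)%N /\
    forall (v : place iota) e, infinity_orders v e ->
      ev P != 0 /\ v (ev P) = - ((j * m + i * d) * e)%N%:Z.
  by exists (j * m + i * d)%N => //; exists j, i.
move=> {P P0 sP} n; elim: n => [|n IH] P n_m P0 sP.
  by rewrite leqn0 size_poly_eq0 (negPf P0) in sP.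
pose a := P`_n; pose k := (size a).-1; pose P' := take_poly n P.
have eP : P = P' + a%:P * 'X^n.
  rewrite -[LHS](poly_take_drop n P); congr (_ + _ * _).
  have /size1_polyC -> : (size (drop_poly n P) <= 1)%N.
    by rewrite size_drop_poly leq_subLR addn1.
  by rewrite coef_drop_poly add0n.
have top (v : place iota) e : infinity_orders v e -> a != 0 ->
    ev (a%:P * 'X^n) != 0 /\
    v (ev (a%:P * 'X^n)) = - ((k * m + n * d) * e)%N%:Z.
  case=> e0 vz vt a0; have z_neg : v z < 0 by rewrite vz; nia.
  have [n0 va] := ord_horner z_neg a0.
  have t0 : t != 0.
    by apply/eqP=> t0; move: vt; rewrite t0 ord_zero; nia.
  rewrite rmorphM rmorphXn /= eval2C eval2X.
  split; first by rewrite mulf_neq0 // expf_neq0.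
  rewrite ord_mul ?expf_neq0 // ordX // va vz vt !mulNrn -opprD.
  rewrite -[_ *+ k]mulr_natr -[_ *+ n]mulr_natr !natz -!PoszM -PoszD.
  by congr (- Posz _); ring.
have [P'0|P'0] := eqVneq P' 0.
  have a0 : a != 0 by apply: contraNneq P0 => a0; rewrite eP P'0 a0 mul0r addr0.
  exists n, k; split=> // v e inf.
  by rewrite eP P'0 add0r; apply: top.
have [i [j [lt_in H]]] := IH P' (ltnW n_m) P'0 (size_take_poly n P).
have [a0|a0] := eqVneq a 0.
  exists i, j; split; first exact: leqW.
  by move=> v e inf; rewrite eP a0 mul0r addr0; apply: H.
have neqW : (j * m + i * d)%N <> (k * m + n * d)%N.
  move=> eqW; have : (m %| (n - i) * d)%N.
    apply/dvdnP; exists (j - k)%N.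
    rewrite !mulnBl; nia.
  rewrite Gauss_dvdl // => /dvdn_leq; lia.
case: (ltngtP (j * m + i * d) (k * m + n * d))%N => // ltW.
  exists n, k; split=> // v e inf.
  have [n1 e1] := H v e inf; have [n2 e2] := top v e inf a0.
  rewrite eP addrC rmorphD -e2; apply: ord_lt_add => //.
  by rewrite e1 e2; case: inf => e0 _ _; nia.
exists i, j; split; first exact: leqW.
move=> v e inf.
have [n1 e1] := H v e inf; have [n2 e2] := top v e inf a0.
rewrite eP rmorphD -e1; apply: ord_lt_add => //.
by rewrite e1 e2; case: inf => e0 _ _; nia.
Qed.

Hypothesis gen : generated_by iota t z.
Variable v : place iota.
Hypothesis v_inf : at_infinity t z v.

Lemma ev_reduced_neq0 (P : {poly {poly F}}) :
  P != 0 -> (size P <= m)%N -> ev P != 0.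
Proof.
move=> P0 sP; have [e ve] := at_infinity_orders v_inf.
by have [W _ /(_ _ _ ve)[]] := ord_reduced P0 sP.
Qed.

Lemma horner_z_neq0 (a : {poly F}) : a != 0 -> (map_poly iota a).[z] != 0.
Proof.
move=> a0; rewrite -(eval2C iota t) ev_reduced_neq0 ?polyC_eq0 //.
exact: leq_trans (size_polyC_leq1 a) m_gt0.
Qed.

(** The regular functions form a free module over F[z] with basis t^i, i < m.
    The matrix of the multiplication by [r] in this basis is invertible over
    F(z), as there are no zero divisors; its determinant is a multiple of [r]
    by the adjugate formula. *)
Lemma dvd_univariate (r : {poly {poly F}}) : ev r != 0 ->
  exists r' (a : {poly F}), a != 0 /\ ev (r' * r) = (map_poly iota a).[z].
Proof.
move=> r0.
have /fin_all_exists[B HB] (i : 'I_m) :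
    exists u : 'rV[{poly F}]_m, ev (rVpoly u) = ev ('X^i * r).
  have [q [p [eqp sp]]] := curve_divp ('X^i * r).
  exists (poly_rV p); rewrite poly_rV_K // eqp rmorphD rmorphM /=.
  by rewrite eval2_curve_poly // mulr0 add0r.
pose M := \matrix_i B i.
have mulM (u : 'rV_m) : ev (rVpoly (u *m M)) = ev (rVpoly u * r).
  rewrite mulmx_sum_row linear_sum raddf_sum /= [in RHS](row_sum_delta u).
  rewrite linear_sum mulr_suml raddf_sum; apply: eq_bigr => i _ /=.
  by rewrite !linearZ /= rowK -!mul_polyC !rmorphM /= HB rVpoly_delta rmorphM mulrA.
have rVpoly_eq0 (u : 'rV_m) : ev (rVpoly u) = 0 -> u = 0.
  move=> /eqP u0; apply: (can_inj (@rVpolyK _ m)); rewrite linear0.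
  by apply: contraTeq u0 => /ev_reduced_neq0; apply; apply: size_poly.
exists (rVpoly (row (Ordinal m_gt0) (\adj M))), (\det M); split.
  apply: contraNneq r0 => /eqP/det0P[u u0 uM].
  have /eqP := mulM u; rewrite uM linear0 rmorph0 rmorphM eq_sym mulf_eq0.
  by case/orP=> // /eqP/rVpoly_eq0 ue; rewrite ue eqxx in u0.
rewrite -mulM -row_mul mul_adj_mx -scalemx1 !linearZ /= row1.
by rewrite rVpoly_delta expr0 -mul_polyC mulr1 eval2C.
Qed.

(** Once the denominator is a function of z alone, the numerator can be reduced
    modulo the equation of the curve. *)
Lemma reduced_fraction (f : E) : exists (P : {poly {poly F}}) (a : {poly F}),
  [/\ (size P <= m)%N, a != 0 & f = ev P / (map_poly iota a).[z]].
Proof.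
have [p [r [r0 ->]]] := gen f; have [r' [a [a0 era]]] := dvd_univariate r0.
have [q [P [eP sP]]] := curve_divp (r' * p).
exists P, a; split=> //; apply/eqP; rewrite eqr_div ?horner_z_neq0 //.
have -> : ev P = ev (r' * p).
  by rewrite eP rmorphD rmorphM /= eval2_curve_poly // mulr0 add0r.
by rewrite -era !rmorphM; apply/eqP; ring.
Qed.

Lemma ord_reduced_fraction (f : E) : f != 0 -> exists W1 W2 : nat,
  forall (w : place iota) e, infinity_orders w e ->
    w f = - (W1 * e)%N%:Z + (W2 * e)%N%:Z.
Proof.
have [P [a [sP a0 ->]]] := reduced_fraction f => f0.
have P0 : P != 0 by apply: contraNneq f0 => ->; rewrite rmorph0 mul0r.
have aC0 : a%:P != 0 :> {poly {poly F}} by rewrite polyC_eq0.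
have saC : (size (a%:P : {poly {poly F}}) <= m)%N.
  exact: leq_trans (size_polyC_leq1 a) m_gt0.
have [W1 _ H1] := ord_reduced P0 sP; have [W2 _ H2] := ord_reduced aC0 saC.
exists W1, W2 => w e we; have [P1 wP] := H1 w e we; have [a1 wa] := H2 w e we.
by rewrite -(eval2C iota t) ord_div // wP wa opprK.
Qed.

(** All orders at infinity are multiples of the ramification index, and one of
    them is 1. *)
Lemma infinity_index1 (w : place iota) e : infinity_orders w e -> e = 1%N.
Proof.
move=> we; have [f [f0 wf]] := ord_uniformizer w.
have [W1 [W2 /(_ w e we)]] := ord_reduced_fraction f0; rewrite wf => e1.
suff : (e %| 1)%N by rewrite dvdn1 => /eqP.
by apply/dvdnP; exists (W2 - W1)%N; rewrite mulnBl; lia.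
Qed.

(** The orders at infinity of a reduced fraction do not depend on the place. *)
Lemma infinity_unique (w : place iota) : at_infinity t z w -> same_place w v.
Proof.
have [e ve] := at_infinity_orders v_inf; move=> /at_infinity_orders[e' we] f.
have [->|f0] := eqVneq f 0; first by rewrite !ord_zero.
have [W1 [W2 H]] := ord_reduced_fraction f0.
by rewrite (H _ _ we) (H _ _ ve) (infinity_index1 we) (infinity_index1 ve).
Qed.

(** ** The places at finite distance *)

Section FinitePoint.

Variables (L : finFieldType) (j : {rmorphism F -> L}) (al be : L).
Hypothesis point_eq : (map_poly j G).[be] = al ^+ d.

Local Notation rho := (eval2 j be al).
Local Notation N := #|L|.
Local Notation pi := (z ^+ N - z).

(** Evaluation at the point is well defined on F[z, t]: a polynomial P(T) in
    F[Z][T] that vanishes at (z, t) is a multiple of G(T) - Z^d, as its remainder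
    cannot vanish there without being 0. *)
Lemma eval_point_eq0 (p : {poly {poly F}}) : ev p = 0 -> rho p = 0.
Proof.
have [q [r [-> sr]]] := curve_divp p.
rewrite !rmorphD !rmorphM /= !eval2_curve_poly // !mulr0 !add0r.
have [->|r0 /eqP] := eqVneq r 0; first by rewrite !rmorph0.
by rewrite (negPf (ev_reduced_neq0 r0 sr)).
Qed.

Lemma eval_point_eq (p q : {poly {poly F}}) : ev p = ev q -> rho p = rho q.
Proof.
move=> e; apply/eqP; rewrite -subr_eq0 -raddfB; apply/eqP/eval_point_eq0.
by rewrite raddfB /= e subrr.
Qed.

Lemma ev_neq0 p : rho p != 0 -> ev p != 0.
Proof. by apply: contra_neq => /eval_point_eq0. Qed.

Lemma N_gt0 : (0 < N)%N. Proof. exact: ltnW (finNzRing_gt1 L). Qed.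

Lemma pi_eval2 : pi = ev (('X^N - 'X) : {poly F})%:P.
Proof. by rewrite eval2C rmorphB /= map_polyXn map_polyX !hornerE. Qed.

Lemma size_pi : size ('X^N - 'X : {poly F}) = N.+1.
Proof.
by rewrite size_polyDl size_polyXn // size_polyN size_polyX ltnS finNzRing_gt1.
Qed.

Lemma pi_neq0 : pi != 0.
Proof.
rewrite pi_eval2 eval2C horner_z_neq0 //.
by rewrite -size_poly_gt0 size_pi.
Qed.

(** As G' is the constant [c], the quotient w = (G(t)^N - G(t)) / (t^N - t) takes
    the value c at the point, and w (t^N - t) = z^(N d) - z^d is divisible by
    z^N - z.  Hence t^N - t, and with it p^N - p for each regular p, is divisible
    by z^N - z in the local ring. *)
Lemma Frobenius_congr : exists w, rho w != 0 /\
  forall p, exists p1, ev w * (ev p ^+ N - ev p) = pi * ev p1.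
Proof.
have [D eD] := dvdp_Frobenius_sub j G.
have evX (g : {poly F}) : exists g1 : {poly F},
    (map_poly iota g).[z] ^+ N - (map_poly iota g).[z] = pi * ev g1%:P.
  have [g1 e] := dvdp_Frobenius_sub j g; exists g1.
  have := congr1 (fun p => (map_poly iota p).[z]) e.
  rewrite rmorphB rmorphXn rmorphM rmorphB /= map_polyXn map_polyX !hornerE.
  by rewrite eval2C => ->; rewrite mulrC.
have [q eq] : exists q, ev (map_poly polyC D) * (t ^+ N - t) = pi * ev q.
  have [q eq] := evX 'X^d; exists q%:P; rewrite -eq map_polyXn hornerXn -curve_eq.
  have := congr1 (fun p => (map_poly iota p).[t]) eD.
  rewrite rmorphB rmorphXn rmorphM rmorphB /= map_polyXn map_polyX !hornerE.
  by rewrite eval2_polyC => ->.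
exists (map_poly polyC D); split.
  by rewrite eval2_polyC (Frobenius_quotient j be deriv_G eD) fmorph_eq0.
set w := ev (map_poly _ _) in eq *.
elim/poly_ind => [|p a [p1 IH]].
  by exists 0; rewrite !rmorph0 expr0n (gtn_eqF N_gt0) subrr !mulr0.
have [a1 ea] := evX a.
exists (p1 * 'X^N + p * q + map_poly polyC D * a1%:P).
rewrite !rmorphD !rmorphM /= eval2X eval2C -/w.
rewrite exprDn_pchar ?(card_pnat_pchar j iota) //.
rewrite rmorphXn /= eval2X exprMn.
have -> : ev p ^+ N * t ^+ N + (map_poly iota a).[z] ^+ N
    - (ev p * t + (map_poly iota a).[z])
  = (ev p ^+ N - ev p) * t ^+ N + ev p * (t ^+ N - t)
    + ((map_poly iota a).[z] ^+ N - (map_poly iota a).[z]) by ring.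
rewrite ea 2!mulrDr [w * (_ * t ^+ N)]mulrA IH.
rewrite [w * (ev p * _)]mulrCA eq; ring.
Qed.

(** The local ring of the curve at the point; [rho r] is the value of [ev r]. *)
Definition local_ring (f : E) := exists p r, rho r != 0 /\ f = ev p / ev r.

(** If [p] is not invertible at the point, then the congruence p^N = p lets a
    factor z^N - z be taken out of [p], and [a] loses a factor vanishing at the
    point; so this stops, by induction on the degree of [a].  The factor [u]
    collects the functions invertible at the point that appear on the way. *)
Lemma regular_factor (a : {poly F}) p p' u : a != 0 -> rho u != 0 ->
  ev p * ev p' = ev u * (map_poly iota a).[z] ->
  exists k q r, [/\ rho q != 0, rho r != 0 & ev p = pi ^+ k * (ev q / ev r)].
Proof.
have [w [w0 Hw]] := Frobenius_congr.
have [n] := ubnP (size a); elim: n => // n IH in a p p' u * => sa a0 u0 epp'.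
have [p_0|p0] := eqVneq (rho p) 0; last first.
  by exists 0%N, p, 1; rewrite rmorph1 oner_neq0 mul1r rmorph1 divr1.
have [p1 ep1] := Hw p.
pose w1 := w * (p ^+ N.-1 - 1).
have w10 : rho w1 != 0.
  rewrite rmorphM mulf_neq0 // raddfB /= rmorphXn rmorph1 /= p_0 expr0n.
  have -> : (N.-1 == 0)%N = false.
    by rewrite gtn_eqF // -ltnS prednK ?finNzRing_gt1 // N_gt0.
  by rewrite sub0r oppr_eq0 oner_neq0.
have ew1 : ev w1 * ev p = pi * ev p1.
  rewrite -ep1 rmorphM raddfB /= rmorphXn rmorph1 /= -mulrA; congr (_ * _).
  by rewrite mulrBl mul1r -exprSr prednK // N_gt0.
clearbody w1; have a_al : root (map_poly j a) al.
  rewrite /root -(eval2C j be); have /eqP : rho (p * p') = rho (u * a%:P).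
    by apply: eval_point_eq; rewrite !rmorphM epp' /= eval2C.
  by rewrite !rmorphM /= p_0 mul0r eq_sym mulf_eq0 (negPf u0).
(* g vanishes at the point, but its cofactor in X^N - X does not *)
pose g := gcdp a ('X^N - 'X).
have [a1 ea] : exists a1, a = a1 * g by apply/dvdpP/dvdp_gcdl.
have [b eb] : exists b, 'X^N - 'X = b * g by apply/dvdpP/dvdp_gcdr.
have g_al : root (map_poly j g) al.
  rewrite gcdp_map root_gcd a_al rmorphB /= map_polyXn map_polyX /root !hornerE.
  by rewrite expf_card subrr.
clearbody g; have b_al := Frobenius_simple_root eb g_al.
have epi : pi = (map_poly iota b).[z] * (map_poly iota g).[z].
  by rewrite pi_eval2 eval2C eb rmorphM hornerM.
have [a10 g0] : a1 != 0 /\ g != 0.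
  by apply/andP; rewrite -negb_or -mulf_eq0 -ea.
have sa1 : (size a1 < n)%N.
  have sg : (1 < size g)%N.
    by rewrite -(size_map_poly j); apply: root_size_gt1 g_al; rewrite map_poly_eq0.
  move: sa; rewrite ea size_mul // ltnS; apply: leq_trans.
  by rewrite -(ltn_predK sg) addnS /= -addn1 leq_add2l -ltnS (ltn_predK sg).
have u10 : rho (w1 * u) != 0 by rewrite rmorphM mulf_neq0.
have ep1a : ev p1 * ev (p' * b%:P) = ev (w1 * u) * (map_poly iota a1).[z].
  apply: (mulfI pi_neq0).
  rewrite mulrA -ew1 !rmorphM /= eval2C.
  transitivity (ev w1 * (ev p * ev p') * (map_poly iota b).[z]); first by ring.
  rewrite epp' ea rmorphM hornerM epi; ring.
have [k [q [r [q0 r0 e]]]] := IH a1 p1 _ _ sa1 a10 u10 ep1a.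
exists k.+1, q, (w1 * r); split=> //; first by rewrite rmorphM mulf_neq0.
apply: (mulfI (ev_neq0 w10)); rewrite ew1 e rmorphM exprS /=.
by field; rewrite !ev_neq0.
Qed.

Lemma local_factor f : f != 0 -> exists k : int,
  [/\ f / pi ^ k != 0, local_ring (f / pi ^ k) & local_ring (f / pi ^ k)^-1].
Proof.
have fact p : ev p != 0 -> exists (k : nat) q r,
    [/\ rho q != 0, rho r != 0 & ev p = pi ^+ k * (ev q / ev r)].
  move=> /dvd_univariate[p' [a [a0 e]]]; apply: (@regular_factor a p p' 1) => //.
    by rewrite rmorph1 oner_neq0.
  by rewrite rmorph1 mul1r -e rmorphM mulrC.
move=> f0; have [p [r [r0 ef]]] := gen f.
have p0 : ev p != 0 by apply: contraNneq f0 => p0; rewrite ef p0 mul0r.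
have [k1 [q1 [r1 [q10 r10 e1]]]] := fact p p0.
have [k2 [q2 [r2 [q20 r20 e2]]]] := fact r r0.
exists (k1%:Z - k2%:Z).
have -> : f / pi ^ (k1%:Z - k2%:Z) = ev (q1 * r2) / ev (r1 * q2).
  rewrite ef e1 e2 expfzDr ?pi_neq0 // -exprnN -exprnP !rmorphM /=.
  by field; rewrite !ev_neq0 ?expf_neq0 ?pi_neq0.
have n1 : rho (q1 * r2) != 0 by rewrite rmorphM mulf_neq0.
have n2 : rho (r1 * q2) != 0 by rewrite rmorphM mulf_neq0.
split; first by rewrite mulf_neq0 ?invr_eq0 ?ev_neq0.
  by exists (q1 * r2), (r1 * q2).
by exists (r1 * q2), (q1 * r2); rewrite invf_div.
Qed.

Lemma local_ring_eval2 p : local_ring (ev p).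
Proof. by exists p, 1; rewrite !rmorph1 oner_neq0 divr1. Qed.

Lemma local_ring_inv p : local_ring (ev p)^-1 -> ev p != 0 -> rho p != 0.
Proof.
move=> [q [r [r0 e]]] p0; apply: contraNneq (r0) => p_0.
have /eval_point_eq -> : ev r = ev (q * p).
  rewrite rmorphM /= -[ev q](divfK (ev_neq0 r0)) -e mulrAC mulVf //.
  by rewrite mul1r.
by rewrite rmorphM /= p_0 mulr0.
Qed.

(** Each function is a power of z^N - z times a unit of the local ring, by
    [regular_factor] for its numerator and its denominator. *)
Lemma place_of_point : exists Q : place iota,
  [/\ 0 <= Q t, 0 <= Q z, forall p, rho p != 0 -> Q (ev p) = 0
    & forall p, ev p != 0 -> rho p = 0 -> 0 < Q (ev p)].
Proof.
have O_const a : local_ring (iota a).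
  have -> : iota a = ev (a%:P)%:P by rewrite eval2C map_polyC hornerC.
  exact: local_ring_eval2.
have O_add f g : local_ring f -> local_ring g -> local_ring (f + g).
  move=> [p [r [r0 ->]]] [q [s [s0 ->]]].
  exists (p * s + q * r), (r * s); rewrite !rmorphD !rmorphM mulf_neq0 //=.
  by split=> //; rewrite addf_div // ev_neq0.
have O_mul f g : local_ring f -> local_ring g -> local_ring (f * g).
  move=> [p [r [r0 ->]]] [q [s [s0 ->]]].
  by exists (p * q), (r * s); rewrite !rmorphM mulf_neq0 //= mulf_div.
have rho_pi : rho (('X^N - 'X) : {poly F})%:P = 0.
  by rewrite eval2C rmorphB /= map_polyXn map_polyX !hornerE expf_card subrr.
have O_pi : local_ring pi by rewrite pi_eval2; apply: local_ring_eval2.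
have nO_piV : ~ local_ring pi^-1.
  rewrite pi_eval2 => /local_ring_inv; rewrite -pi_eval2 pi_neq0 rho_pi eqxx.
  by move=> /(_ isT).
have [Q OQ] := place_of_uniformizer O_const O_add O_mul pi_neq0 O_pi nO_piV
  local_factor.
have Q_ge0 p : 0 <= Q (ev p).
  have [->|p0] := eqVneq (ev p) 0; first by rewrite ord_zero.
  by apply/OQ => //; apply: local_ring_eval2.
have QV p : ev p != 0 -> local_ring (ev p)^-1 <-> Q (ev p) <= 0.
  move=> p0; rewrite OQ ?invr_eq0 // -[_^-1]div1r ord_div ?oner_neq0 // ord_one.
  by rewrite sub0r oppr_ge0.
exists Q; split.
- by rewrite -(eval2X iota t z).
- have -> : z = ev 'X%:P by rewrite eval2C map_polyX hornerX.
  exact: Q_ge0.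
- move=> p p0; apply/eqP; rewrite eq_le Q_ge0 andbT; apply/QV; first exact: ev_neq0.
  by exists 1, p; rewrite rmorph1 div1r.
move=> p p0 p_0; rewrite lt_def Q_ge0 andbT; apply/eqP=> Qp.
have /local_ring_inv : local_ring (ev p)^-1 by apply/QV; rewrite ?Qp.
by rewrite p_0 eqxx => /(_ p0).
Qed.

End FinitePoint.

(** ** Regular functions and the semigroup *)

(** If the denominator of a reduced fraction has a root and is prime to the
    numerator, there is a point above that root where the numerator does not
    vanish: the place constructed at that point is a pole. *)
Lemma regular_function (f : E) :
  (forall Q : place iota, 0 <= Q t -> 0 <= Q z -> 0 <= Q f) ->
  exists2 P : {poly {poly F}}, (size P <= m)%N & f = ev P.
Proof.
have [P [a [sP a0 ->]]] := reduced_fraction f.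
have hz := horner_z_neq0.
have [n] := ubnP (size a); elim: n => // n IH in a P sP a0 * => sa Hf.
have [a1|a1] := leqP (size a) 1.
  have [b ea] : exists b, a = b%:P by exists a`_0; apply: size1_polyC.
  exists ((b^-1)%:P *: P); first exact: leq_trans (size_scale_leq _ _) sP.
  rewrite -mul_polyC rmorphM /= eval2C ea !map_polyC !hornerC /=.
  by rewrite fmorphV mulrC.
have [L [j [al a_al]]] := finite_root a1.
have [P_al|P_al] := boolP (all (fun p => root (map_poly j p) al) P).
  have [g [g_al /dvdpP[b ea] /allP gP]] := common_divisor a_al P_al.
  have /andP[b0 g0] : (b != 0) && (g != 0) by rewrite -negb_or -mulf_eq0 -ea.
  pose P1 := map_poly (fun p => p %/ g) P.
  have eP : P = P1 * g%:P.
    apply/polyP=> i; rewrite coefMC coef_map_id0 ?div0p // divpK //.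
    have [lt_i|ge_i] := ltnP i (size P); first exact/gP/mem_nth.
    by rewrite nth_default // dvdp0.
  have ef : ev P / (map_poly iota a).[z] = ev P1 / (map_poly iota b).[z].
    rewrite eP ea !rmorphM hornerM /= eval2C.
    by field; rewrite !hz.
  rewrite ef in Hf *; apply: IH Hf => //; first exact: leq_trans (size_poly _ _) sP.
  have sg : (1 < size g)%N.
    by rewrite -(size_map_poly j); apply: root_size_gt1 g_al; rewrite map_poly_eq0.
  move: sa; rewrite ea size_mul // ltnS; apply: leq_trans.
  by rewrite -(ltn_predK sg) addnS /= -addn1 leq_add2l -ltnS (ltn_predK sg).
have [L' [k [be [be_G be_P]]]] := separating_point sP P_al.
have [Q [Qt Qz Q_unit Q_pos]] := place_of_point be_G.
have P0 : ev P != 0.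
  apply: contraNneq be_P => P0.
  by apply/eqP; apply: (eval_point_eq0 be_G).
have Qa : 0 < Q (map_poly iota a).[z].
  rewrite -(eval2C iota t); apply: Q_pos; rewrite eval2C ?hz //.
  by rewrite map_poly_comp horner_map (rootP a_al) rmorph0.
have := Hf Q Qt Qz; rewrite ord_div ?hz // Q_unit // sub0r oppr_ge0.
by rewrite leNgt Qa.
Qed.

(** A function with no pole at finite distance is a polynomial in z and t, whose
    pole order at infinity is the weight of one of its monomials; each monomial
    z^i t^j in turn has no other pole, as there is no other place at infinity. *)
Lemma weierstrass_semigroup_curve n :
  weierstrass_semigroup v n <-> semigroup2 m d n.
Proof.
have [e ve] := at_infinity_orders v_inf.
have e1 := infinity_index1 ve.
rewrite {}e1 {e} in ve; split.
  case=> f [f0 [vf Qf]].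
  have [Q Qt Qz|P sP ef] := @regular_function f.
    have nQ : ~ same_place Q v.
      move=> QP; move: v_inf; rewrite /at_infinity -!QP !ltNge Qt Qz.
      by case.
    by have := Qf Q nQ; rewrite /pole_order leNgt; case: ifP => // neg; lia.
  have P0 : P != 0 by apply: contraNneq f0 => P0; rewrite ef P0 rmorph0.
  have [W W_in /(_ v 1%N ve)[_ vP]] := ord_reduced P0 sP.
  suff <- : W = n by [].
  by rewrite -vf /pole_order ef vP muln1; case: ifP => neg; lia.
case=> i [l ->]; case: ve => _ vz vt.
have t0 : t != 0 by apply/eqP=> t0; move: vt; rewrite t0 ord_zero; lia.
have z0 : z != 0 by apply/eqP=> z0; move: vz; rewrite z0 ord_zero; lia.
exists (z ^+ i * t ^+ l); split; first by rewrite mulf_neq0 // expf_neq0.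
have efl (Q : place iota) : Q (z ^+ i * t ^+ l) = Q z *+ i + Q t *+ l.
  by rewrite ord_mul ?expf_neq0 // !ordX.
split=> [|Q nQ].
  rewrite /pole_order efl vz vt !muln1; case: ifP; nia.
rewrite /pole_order efl ltNge; suff -> : 0 <= Q z *+ i + Q t *+ l by [].
have [Qt Qz] : 0 <= Q t /\ 0 <= Q z.
  split; rewrite leNgt; apply/negP=> neg; apply: nQ.
    by apply: infinity_unique; left.
  by apply: infinity_unique; right.
by rewrite addr_ge0 // mulrn_wge0.
Qed.

End Curve.

(** * The equation of the quotient curve *)

Section AdditiveQuotient.

Variables (F : finFieldType) (Hs : {set F}).
Hypothesis Hs_group : zmod_closed Hs.

Definition translate_prod : {poly F} := \prod_(a in Hs) ('X + a%:P).

Local Notation T := translate_prod.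

Lemma translate_prodE : T = \prod_(a <- enum Hs) ('X - a%:P).
Proof.
have [H0 HB] := Hs_group.
have Hopp a : (- a \in Hs) = (a \in Hs).
  have opp b : b \in Hs -> - b \in Hs by move=> bH; rewrite -sub0r HB.
  by apply/idP/idP=> [/opp|/opp //]; rewrite opprK.
rewrite big_enum /T (reindex_inj oppr_inj) /=.
by apply: eq_big => [a | a _]; rewrite ?Hopp // polyCN.
Qed.

Lemma size_translate_prod : size T = #|Hs|.+1.
Proof. by rewrite translate_prodE size_prod_XsubC cardE. Qed.

Lemma monic_translate_prod : T \is monic.
Proof. by rewrite translate_prodE monic_prod_XsubC. Qed.

Lemma translate_prod_shift a : a \in Hs -> T \Po ('X + a%:P) = T.
Proof.
have [H0 HB] := Hs_group; move=> aH.
have HD b : (b - a \in Hs) = (b \in Hs).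
  apply/idP/idP=> [baH | bH]; last exact: HB.
  have aN : - a \in Hs by rewrite -sub0r HB.
  by have := HB _ _ baH aN; rewrite opprK subrK.
rewrite /T rmorph_prod (reindex_inj (addIr (- a))) /=.
apply: eq_big => [b | b _]; first exact: HD.
by rewrite comp_polyD comp_polyX comp_polyC -addrA -polyCD [a + _]addrC subrK.
Qed.

(** A polynomial [g] invariant under the translations by [Hs] takes the value
    g(0) at all points of [Hs], so that g - g(0) is divisible by [T]; the
    quotient is again invariant. *)
Lemma translation_invariant (g : {poly F}) :
  (forall a, a \in Hs -> g \Po ('X + a%:P) = g) -> exists G, g = G \Po T.
Proof.
have [H0 _] := Hs_group; have Hs_gt0 : (0 < #|Hs|)%N by apply/card_gt0P; exists 0.
have [n] := ubnP (size g); elim: n => // n IH in g * => sg inv.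
have [s1|s1] := leqP (size g) 1.
  by exists g; rewrite (size1_polyC s1) comp_polyC.
have /dvdpP[q eq] : T %| g - (g.[0])%:P.
  rewrite translate_prodE uniq_roots_dvdp ?uniq_rootsE ?enum_uniq //.
  apply/allP=> a; rewrite mem_enum => aH; rewrite /root hornerD hornerN hornerC.
  by rewrite -[in g.[0]](inv a aH) horner_comp !hornerE subrr.
have g0 : g - (g.[0])%:P != 0.
  apply: contraTneq s1 => /eqP; rewrite subr_eq0 => /eqP->.
  by rewrite -leqNgt size_polyC_leq1.
have /andP[q0 T0] : (q != 0) && (T != 0) by rewrite -negb_or -mulf_eq0 -eq.
have [||G eG] := IH q.
- have : (size (g - (g.[0])%:P)%R <= size g)%N.
    rewrite (leq_trans (size_polyD _ _)) // geq_max leqnn size_polyN.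
    exact: leq_trans (size_polyC_leq1 _) (ltnW s1).
  rewrite eq size_mul // size_translate_prod addnS /= => le.
  apply: leq_trans (leq_trans le _); last by rewrite -ltnS.
  by rewrite -addn1 leq_add2l.
- move=> a aH; apply: (mulIf T0); rewrite -eq -[in LHS](translate_prod_shift aH).
  by rewrite -comp_polyM -eq comp_polyB comp_polyC inv.
exists (G * 'X + (g.[0])%:P).
by rewrite comp_polyD comp_polyM comp_polyX comp_polyC -eG -eq subrK.
Qed.

End AdditiveQuotient.

(** The translations by [Hs] preserve X^q0 + X, which is therefore a polynomial
    in [translate_prod Hs]; the derivative of X^q0 + X is 1, so that G' is constant
    by the chain rule. *)
Lemma additive_quotient (p k : nat) (F : finFieldType) (Hs : {set F}) :
    p \in [pchar F] -> (0 < k)%N -> zmod_closed Hs ->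
    Hs \subset [set c : F | c ^+ (p ^ k) + c == 0] ->
  exists (G : {poly F}) (c : F),
  [/\ G \is monic, ((size G).-1 * #|Hs|)%N = (p ^ k)%N, c != 0, G^`() = c%:P
    & 'X^(p ^ k) + 'X = G \Po translate_prod Hs].
Proof.
move=> pF k_gt0 Hs_group /subsetP HsH; set q0 := (p ^ k)%N.
have pr_p : prime p by case/andP: pF.
have q0_gt1 : (1 < q0)%N by rewrite -{1}(exp1n k) ltn_exp2r ?prime_gt1.
have Hs_gt0 : (0 < #|Hs|)%N by case: Hs_group => H0 _; apply/card_gt0P; exists 0.
have q0_pnat : [pchar {poly F}].-nat q0.
  rewrite (eq_pnat _ (pchar_poly F)) (eq_pnat _ (pcharf_eq pF)).
  by rewrite pnatX pnat_id.
have sN : size ('X^q0 + 'X : {poly F}) = q0.+1.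
  by rewrite size_polyDl size_polyXn // size_polyX.
have dN : ('X^q0 + 'X : {poly F})^`() = 1.
  rewrite derivD derivXn derivX -mulr_natr.
  have -> : q0%:R = 0 :> {poly F}.
    have pP : p \in [pchar {poly F}] by rewrite pchar_poly.
    by rewrite /q0 -(prednK k_gt0) expnS natrM (pcharf0 pP) mul0r.
  by rewrite mulr0 add0r.
have [G eG] : exists G, 'X^q0 + 'X = G \Po translate_prod Hs.
  apply: translation_invariant => // a /HsH; rewrite inE => /eqP a0.
  rewrite comp_polyD comp_Xn_poly comp_polyX exprDn_pchar // -polyC_exp.
  by rewrite addrACA -polyCD a0 addr0.
have sT := size_translate_prod Hs_group.
have sG : ((size G).-1 * #|Hs|)%N = q0.
  by have := size_comp_poly G (translate_prod Hs); rewrite -eG sN sT.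
have [c dG] : exists c, G^`() = c%:P.
  exists (G^`())`_0; apply: size1_polyC.
  have /eqP : size (('X^q0 + 'X : {poly F})^`()) = 1%N by rewrite dN size_poly1.
  rewrite eG deriv_comp size_mul_eq1 => /andP[/eqP s1 _].
  have /eqP := size_comp_poly G^`() (translate_prod Hs).
  rewrite s1 sT eq_sym muln_eq0 [(#|Hs|.+1).-1]/= (gtn_eqF Hs_gt0) orbF.
  by case: (size _) => [|[]].
exists G, c; split=> //.
- have : lead_coef ('X^q0 + 'X : {poly F}) = 1.
    by rewrite lead_coefDl ?lead_coefXn // size_polyXn size_polyX.
  rewrite eG lead_coef_comp ?sT // (monicP (monic_translate_prod Hs_group)).
  by rewrite expr1n mulr1 => /monicP.
apply: contra_eqN dN => /eqP c0.
by rewrite eG deriv_comp dG c0 comp_poly0 mul0r eq_sym oner_neq0.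
Qed.

(** * The semigroup of the image of the Hermitian curve *)

Theorem proposition5p2 (q0 q s : nat) (hq0 : prime_power q0)
  (hq : q = (q0 ^ 2)%N) (hs : (s %| q0)%N)
  (F : finFieldType) (hF : #|F| = q)
  (Hs : {set F})
  (HsH : Hs \subset [set c : F | c ^+ q0 + c == 0])
  (Hs_group : zmod_closed Hs) (Hs_card : #|Hs| = s)
  (K : fieldType) (iotaK : {rmorphism F -> K}) (x y : K)
  (hK : plane_curve_function_field iotaK (hermitian_poly F q0) x y)
  (E : fieldType) (iotaE : {rmorphism F -> E}) (phi : {rmorphism E -> K})
  (t z : E)
  (hE : image_curve_function_field iotaK iotaE phi
          (\prod_(a in Hs) (x + iotaK a)) y t z)
  (Pinf : place iotaK) (hPinf : at_infinity x y Pinf)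
  (Pbar : place iotaE) (hPbar : image_place phi Pinf Pbar) :
  forall n : nat,
    weierstrass_semigroup Pbar n <-> semigroup2 (q0 %/ s) q0.+1 n.
Proof.
have [p [k [pr_p k_gt0 eq0]]] := hq0.
have pF : p \in [pchar F].
  by apply: (@card_finPcharP _ p (k * 2)) => //; rewrite hF hq eq0 -expnM.
have q0_gt0 : (0 < q0)%N by rewrite eq0 expn_gt0 prime_gt0.
have s_gt0 : (0 < s)%N := dvdn_gt0 q0_gt0 hs.
rewrite eq0 in HsH.
have [G [c [G_monic sG c0 dG eG]]] := additive_quotient pF k_gt0 Hs_group HsH.
rewrite -eq0 Hs_card in sG eG.
have size_G : size G = (q0 %/ s).+1.
  by rewrite -sG mulnK // prednK // size_poly_gt0 monic_neq0.
have m_gt0 : (0 < q0 %/ s)%N by rewrite divn_gt0 // dvdn_leq.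
have co : coprime (q0 %/ s) q0.+1.
  by apply: coprime_dvdl (dvdn_div hs) _; rewrite coprimenS.
have [phi_c phi_t phi_z gen] := hE.
have herm : x ^+ q0 + x = y ^+ q0.+1.
  have /hK.1 : exists r, hermitian_poly F q0 = r * hermitian_poly F q0.
    by exists 1; rewrite mul1r.
  rewrite /hermitian_poly raddfB /= rmorphXn raddfD /= rmorphXn /= eval2X.
  rewrite eval2C map_polyX hornerX.
  by move=> /eqP; rewrite subr_eq0 => /eqP.
have phi_map (g : {poly F}) : map_poly phi (map_poly iotaE g) = map_poly iotaK g.
  by rewrite -map_poly_comp; apply: eq_map_poly.
have curve_eq : (map_poly iotaE G).[t] = z ^+ q0.+1.
  apply: (fmorph_inj phi); rewrite -horner_map rmorphXn phi_map /= phi_z -herm.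
  have -> : phi t = (map_poly iotaK (translate_prod Hs)).[x].
    rewrite phi_t rmorph_prod horner_prod; apply: eq_bigr => a _.
    by rewrite rmorphD /= map_polyX map_polyC !hornerE.
  rewrite -horner_comp -map_comp_poly -eG rmorphD /= map_polyXn map_polyX.
  by rewrite !hornerE.
have Pbar_inf : at_infinity t z Pbar.
  (* a pole of x is a pole of y, since x^q0 is the dominant term of x^q0 + x *)
  right; rewrite ltNge; apply/negP=> /hPbar; rewrite phi_z leNgt.
  case: hPinf => [Px | -> //]; rewrite -leNgt => Py.
  have x0 : x != 0 by apply: contraTneq Px => ->; rewrite ord_zero.
  have xq0 : x ^+ q0 != 0 by rewrite expf_neq0.
  have q0_gt1 : (1 < q0)%N by rewrite eq0 -{1}(exp1n k) ltn_exp2r ?prime_gt1.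
  have [|y0 vxy] := ord_lt_add (v := Pinf) xq0 x0.
    by rewrite ordX // -[ltRHS]mulr1n ltr_nMn2l.
  have : Pinf (y ^+ q0.+1) < 0 by rewrite -herm vxy ordX // pmulrn_llt0.
  rewrite herm expf_eq0 /= in y0.
  by rewrite ordX // ltNge mulrn_wge0.
move=> n.
exact: (weierstrass_semigroup_curve G_monic size_G m_gt0 _ co c0 dG curve_eq gen).
Qed.
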